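(* Let $d\ge 1$ and let $\mathcal{U}$ be a $d$-dimensional update family. Then $p_c(\mathbb{Z}^d,\mathcal{U})=1$ if and only if $\mathcal{S}(\mathcal{U})=\mathbf{S}^{d-1}$.
   Context: A $d$-dimensional update family is a finite collection $\mathcal{U}=\{X_1,\dots,X_m\}$ of finite, non-empty subsets of $\mathbb{Z}^d\setminus\{\mathbf{0}\}$. Given $A\subset\mathbb{Z}^d$, set $A_0=A$ and, for $t\ge 1$, $A_t=A_{t-1}\cup\{x\in\mathbb{Z}^d : x+X\subset A_{t-1}\text{ for some }X\in\mathcal{U}\}$. The $\mathcal{U}$-closure of $A$ is $[A]_{\mathcal{U}}:=\bigcup_{t\ge 0}A_t$. Write $\mathbb{P}_p$ for the law of a $p$-random set $A\subset\mathbb{Z}^d$ (each site of $\mathbb{Z}^d$ is included in $A$ independently with probability $p$). The critical probability is $p_c(\mathbb{Z}^d,\mathcal{U}):=\inf\{p : \mathbb{P}_p([A]_{\mathcal{U}}=\mathbb{Z}^d)\ge 1/2\}$. Let $\mathbf{S}^{d-1}$ be the unit sphere in $\mathbb{R}^d$. For $u\in\mathbf{S}^{d-1}$ let $\mathbb{H}_u^d:=\{x\in\mathbb{Z}^d : \langle x,u\rangle<0\}$. The set of stable directions is $\mathcal{S}(\mathcal{U}):=\{u\in\mathbf{S}^{d-1} : [\mathbb{H}_u^d]_{\mathcal{U}}=\mathbb{H}_u^d\}$. *)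

(* Defs.v *)
From HB Require Import structures.
From mathcomp Require Import all_boot all_order all_algebra finmap.
From mathcomp Require Import all_classical all_reals all_analysis.
From mathcomp Require Import ring lra.

Set Implicit Arguments.
Unset Strict Implicit.
Unset Printing Implicit Defensive.
Import Order.TTheory GRing.Theory Num.Theory.
Import numFieldNormedType.Exports.

Local Open Scope classical_set_scope.
Local Open Scope ring_scope.

Definition update_family (d : nat) (U : {fset {fset 'rV[int]_d}}) : Prop :=
  forall X, X \in U -> X != fset0 /\ 0 \notin X.

Definition update (d : nat) (U : {fset {fset 'rV[int]_d}})
    (A : set 'rV[int]_d) : set 'rV[int]_d :=
  A `|` [set x | exists2 X, X \in U & forall y, y \in X -> A (x + y)].

Definition closure_of (d : nat) (U : {fset {fset 'rV[int]_d}})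
    (A : set 'rV[int]_d) : set 'rV[int]_d :=
  \bigcup_t iter t (update U) A.

Definition unit_sphere (R : realType) (d : nat) : set 'rV[R]_d :=
  [set u | \sum_i u 0 i ^+ 2 = 1].

Definition half_space (R : realType) (d : nat) (u : 'rV[R]_d) :
    set 'rV[int]_d :=
  [set x | \sum_i (x 0 i)%:~R * u 0 i < 0].

Definition stable_directions (R : realType) (d : nat)
    (U : {fset {fset 'rV[int]_d}}) : set 'rV[R]_d :=
  [set u | unit_sphere u /\ closure_of U (half_space u) = half_space u].

(* Random subsets of a countable set T: the sample space is [set T], with the
   product sigma-algebra, i.e. the one generated by the events {x \in A}. *)

Definition site_event (T : Type) (x : T) : set (set T) := [set A | A x].

Definition random_set_space (T : Type) :=
  g_sigma_algebraType (range (@site_event T)).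

Definition p_random_law (R : realType) (T : choiceType) (p : R)
    (P : probability (random_set_space T) R) : Prop :=
  (forall x : T, P (site_event x) = p%:E) /\
  (forall F : {fset T}, P (\bigcap_(x in [set` F]) site_event x) =
    \prod_(x <- F) P (site_event x))%E.

(* Existence of the p-random law: take a uniform point of [0, 1[ and read off
   its sequence of p-biased digits. *)
Section p_random_law_exists.
Context (R : realType) (p : R) (p0 : 0 <= p) (p1 : p <= 1).

(* [digit n a l] is the event that the n-th digit of a point of [a, a + l[ is
   1 when intervals are repeatedly cut in proportions p (digit 1) and 1 - p
   (digit 0). *)
Fixpoint digit (n : nat) (a l : R) : set R :=
  if n is m.+1 then
    (`]-oo, a + p * l[ `&` digit m a (p * l)) `|`
    (`[a + p * l, +oo[ `&` digit m (a + p * l) ((1 - p) * l))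
  else `]-oo, a + p * l[.

Lemma measurable_digit n a l : measurable (digit n a l).
Proof.
elim: n a l => [|n IH] a l /=; first exact: measurable_itv.
by apply: measurableU; apply: measurableI => //; exact: measurable_itv.
Qed.

Let cylinder (c : seq bool) (a l : R) : set R :=
  [set y | a <= y < a + l /\
     forall i, nth false c i -> digit i a l y].

Let cylinder_nil a l : cylinder [::] a l = `[a, a + l[%classic.
Proof.
by apply/seteqP; split=> y /=; rewrite in_itv /= => H; [case: H|split => // i; rewrite nth_nil].
Qed.

Let cylinder_cons b c a l : 0 <= l ->
  cylinder (b :: c) a l = cylinder c a (p * l) `|`
    (if b then set0 else cylinder c (a + p * l) ((1 - p) * l)).
Proof.
move=> l0.
have pl0 : 0 <= p * l by rewrite mulr_ge0.
have ql0 : 0 <= (1 - p) * l by rewrite mulr_ge0 // subr_ge0.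
have lE : a + p * l + (1 - p) * l = a + l by ring.
apply/seteqP; split => y.
- move=> [/andP[ay yl] H].
  have [yp|yp] := ltP y (a + p * l).
    left; split; first by rewrite ay yp.
    move=> i ci; have /= := H i.+1 ci.
    by rewrite !in_itv /= yp leNgt yp /= => -[[]|[]].
  case: b H => H.
    by have /= := H 0%N isT; rewrite in_itv /= ltNge yp.
  right; split; first by rewrite yp lE.
  move=> i ci; have /= := H i.+1 ci.
  by rewrite !in_itv /= yp ltNge yp /= => -[[]|[]].
- case=> [[/andP[ay yl] H]|].
    split; first by rewrite ay /= (lt_le_trans yl)// -lE lerDl.
    by case=> [_|i ci] /=; rewrite !in_itv /= yl //; left; split => //; exact: H.
  case: b => // -[/andP[ay yl] H].
  split; first by rewrite -lE yl andbT (le_trans _ ay)// lerDl.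
  by case=> [//|i ci] /=; rewrite !in_itv /= ay //; right; split => //; exact: H.
Qed.

Let measurable_cylinder c a l : 0 <= l -> measurable (cylinder c a l).
Proof.
elim: c a l => [|b c IH] a l l0; first by rewrite cylinder_nil; exact: measurable_itv.
rewrite cylinder_cons//; apply: measurableU; first by apply: IH; rewrite mulr_ge0.
by case: b => //; apply: IH; rewrite mulr_ge0 // subr_ge0.
Qed.

Let lebesgue_cylinder c a l : 0 <= l ->
  lebesgue_measure (cylinder c a l) = (l * p ^+ count id c)%:E.
Proof.
elim: c a l => [|b c IH] a l l0.
  rewrite cylinder_nil lebesgue_measure_itv /= lte_fin expr0 mulr1.
  case: ltP => [_|]; first by rewrite -EFinB addrC addKr.
  by rewrite gerDl => l0'; congr EFin; apply: le_anti; rewrite l0 l0'.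
have pl0 : 0 <= p * l by rewrite mulr_ge0.
have ql0 : 0 <= (1 - p) * l by rewrite mulr_ge0 // subr_ge0.
rewrite cylinder_cons//; case: b => /=.
  by rewrite setU0 IH// exprS; congr EFin; ring.
rewrite measureU.
- by rewrite [X in (X + _)%E]IH// [X in (_ + X)%E]IH// -EFinD; congr EFin; ring.
- exact: measurable_cylinder.
- exact: measurable_cylinder.
- apply/seteqP; split => // y [[/andP[_ y1] _] [/andP[y2 _] _]].
  by move: (lt_le_trans y1 y2); rewrite ltxx.
Qed.

Definition uniform01 : set (measurableTypeR R) -> \bar R :=
  mrestr lebesgue_measure (measurable_itv `[0, 1[).

Let uniform01_measure : {measure set (measurableTypeR R) -> \bar R} :=
  mrestr lebesgue_measure (measurable_itv `[0, 1[).

Let uniform01_setT : uniform01 setT = 1%E.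
Proof.
by rewrite /uniform01 /mrestr setTI lebesgue_measure_itv /= lte_fin ltr01 sube0.
Qed.

HB.instance Definition _ := Measure.copy uniform01 uniform01_measure.
HB.instance Definition _ :=
  Measure_isProbability.Build _ _ R uniform01 uniform01_setT.

Context (T : countType).

Definition random_set (y : measurableTypeR R) : random_set_space T :=
  [set x | digit (choice.pickle x) 0 1 y].

Let measurable_random_set : measurable_fun setT random_set.
Proof.
apply: (@measurability _ _ _ (random_set_space T) _ _ (range (@site_event T))) => // _ [_ [x _ <-] <-].
by rewrite setTI; exact: measurable_digit.
Qed.

HB.instance Definition _ :=
  isMeasurableFun.Build _ _ _ _ random_set measurable_random_set.

Let law : probability (random_set_space T) R := distribution uniform01 random_set.

Let law_bigcap (F : {fset T}) :
  law (\bigcap_(x in [set` F]) site_event x) = (p ^+ #|` F|)%:E.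
Proof.
pose s := [seq choice.pickle x | x <- F].
pose N := (\max_(i <- s) i).+1.
pose c := mkseq (fun i => i \in s) N.
have sN i : i \in s -> (i < N)%N.
  by move=> si; rewrite ltnS; apply: leq_bigmax_seq.
have cE i : nth false c i = (i \in s).
  have [iN|Ni] := ltnP i N; first by rewrite nth_mkseq.
  rewrite nth_default ?size_mkseq//; apply/esym/negbTE.
  by apply: contraL Ni => /sN; rewrite -ltnNge.
have -> : #|` F| = count id c.
  rewrite count_map -size_filter -[LHS](size_map choice.pickle (enum_fset F)).
  apply/perm_size/uniq_perm.
  - by rewrite map_inj_uniq ?fset_uniq//; exact: (pcan_inj choice.pickleK).
  - by rewrite filter_uniq ?iota_uniq.
  - move=> i; rewrite mem_filter mem_iota /= add0n.
    by case: (boolP (i \in s)) => //= /sN ->.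
rewrite /law /= /distribution /pushforward /uniform01 /mrestr.
rewrite -(mul1r (p ^+ _)) -(lebesgue_cylinder c 0 ler01).
congr lebesgue_measure; apply/seteqP; split => y /=; rewrite in_itv /=.
- move=> [H y01]; split; first by rewrite add0r.
  by move=> i; rewrite cE => /mapP[x xF ->]; exact: H.
- move=> [y01 H]; split; last by rewrite add0r in y01.
  by move=> x xF; apply: H; rewrite cE; apply/mapP; exists x.
Qed.

Lemma p_random_law_exists : exists P, @p_random_law R T p P.
Proof.
exists law; have mar x : law (site_event x) = p%:E.
  have := law_bigcap [fset x]%fset.
  rewrite cardfs1 expr1 => <-; congr (law _).
  by rewrite set_fset1 bigcap_set1.
split => // F; rewrite law_bigcap.
under eq_bigr do rewrite mar.
rewrite prodEFin; congr EFin.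
by rewrite big_const_seq count_predT iter_mulr_1.
Qed.

End p_random_law_exists.

Definition random_set_law (R : realType) (T : countType) (p : {i01 R}) :
    probability (random_set_space T) R :=
  sval (cid (p_random_law_exists (ge0 p) (le1 p) T)).

Lemma random_set_lawP (R : realType) (T : countType) (p : {i01 R}) :
  p_random_law p%:num (random_set_law T p).
Proof. exact: svalP (cid _). Qed.

Definition percolates (d : nat) (U : {fset {fset 'rV[int]_d}}) :
    set (random_set_space 'rV[int]_d) :=
  [set A | closure_of U A = setT].

Lemma measurable_percolates (d : nat) (U : {fset {fset 'rV[int]_d}}) :
  measurable (percolates U).
Proof.
pose E t x : set (random_set_space 'rV[int]_d) := [set A | iter t (update U) A x].
have mE t x : measurable (E t x).
  elim: t x => [|t IH] x; first by apply: sub_sigma_algebra; exists x.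
  have -> : E t.+1 x = E t x `|` \bigcup_(X in [set` U])
      \bigcap_(y in [set` X]) E t (x + y).
    by apply/seteqP; split => A [|[X XU H]]; [left|right; exists X|left|right; exists X].
  apply: measurableU => //; apply: fin_bigcup_measurable => // X _.
  exact: fin_bigcap_measurable.
have -> : percolates U = \bigcap_x \bigcup_t E t x.
  apply/seteqP; split => A /=.
    move=> AT x _; have : closure_of U A x by rewrite AT.
    by move=> [t _ ?]; exists t.
  by move=> H; apply/seteqP; split.
rewrite -[X in measurable X]setCK setC_bigcap; apply: measurableC.
apply: countable_bigcupT_measurable => [|x]; first exact: countableP.
by apply: measurableC; exact: bigcup_measurable.
Qed.

Definition critical_probability (R : realType) (d : nat)
    (U : {fset {fset 'rV[int]_d}}) : R :=
  inf [set p%:num | p in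
    [set p : {i01 R} | (2^-1%:E <= random_set_law 'rV[int]_d p (percolates U))%E]].

Arguments critical_probability R {d} U.
Arguments stable_directions R {d} U.
Arguments unit_sphere R d : clear implicits.

(* Main.v *)
(* If X in U lies in an open half-space {<y, u> < 0}, then a never infected site
   starts an infinite self-avoiding route, with steps in X, of sites outside A,
   and there is no such route almost surely when (1 - p) |X| < 1; so p_c < 1.
   If all directions are stable, no X in U lies in an open half-space, so by
   Gordan's theorem some nontrivial combination of the elements of X with
   coefficients in nat vanishes. A discrete zonotope K built on the union of U
   then meets x + X for every x in K and X in U, so K stays healthy if it is
   disjoint from A. Disjoint translates of K are independently disjoint from A,
   with the same positive probability, so for p < 1 one of them almost surely
   blocks percolation. *)
Require Import Defs.
From HB Require Import structures.
From mathcomp Require Import all_boot all_order all_algebra finmap.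
From mathcomp Require Import all_classical all_reals all_analysis.
From mathcomp Require Import zify ring lra.

Set Implicit Arguments.
Unset Strict Implicit.
Unset Printing Implicit Defensive.
Import Order.TTheory GRing.Theory Num.Theory.

Local Open Scope classical_set_scope.
Local Open Scope ring_scope.

(** * Gordan's theorem over integer vectors *)

(** Supplies the coefficient of the coordinate being eliminated, between its lower bounds [L] and
    its upper bounds [H]. Induction on both lists covers the cases where one of them is empty. *)
Lemma separating_point (F : realFieldType) (L H : seq F) :
  {in L & H, forall l h, l < h} ->
  exists c, {in L, forall l, l < c} /\ {in H, forall h, c < h}.
Proof.
elim: L => [|l L IHL] LH.
  elim: H {LH} => [|h H [c [_ cH]]]; first by exists 0.
  exists (Num.min c (h - 1)); split => // h'; rewrite inE gt_min => /predU1P[->|/cH ->//].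
  by rewrite ltrBlDr ltrDl ltr01 orbT.
have [l' h l'L hH|c [Lc cH]] := IHL; first by apply: LH; rewrite // inE l'L orbT.
have [c' lc' c'H] : exists2 c', l < c' & {in H, forall h, c' < h}.
  have {LH} : {in H, forall h, l < h} by move=> h; apply: LH; rewrite mem_head.
  elim: H {IHL cH} => [|h H IHH] lH; first by exists (l + 1); rewrite ?ltrDl.
  have [h' h'H|c' lc' c'H] := IHH; first by apply: lH; rewrite inE h'H orbT.
  have lh := lH h (mem_head _ _).
  exists (Num.min c' ((l + h) / 2)); first by rewrite lt_min lc' midf_lt.
  move=> h'; rewrite inE gt_min => /predU1P[->|/c'H ->//].
  by rewrite (midf_lt lh) orbT.
exists (Num.max c c'); split => [l'|h hH]; last by rewrite gt_max cH ?c'H.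
by rewrite inE lt_max => /predU1P[->|/Lc ->//]; rewrite lc' orbT.
Qed.

Section pairing.
Context (R : comNzRingType) (d : nat).
Implicit Types (y z : 'rV[int]_d) (u v : 'rV[R]_d).

(** Over a [realType] this is convertible with the sum in [half_space]. *)
Definition pairing y u : R := \sum_i (y 0 i)%:~R * u 0 i.

Lemma pairingDl y z u : pairing (y + z) u = pairing y u + pairing z u.
Proof. by rewrite -big_split; apply: eq_bigr => i _; rewrite mxE intrD mulrDl. Qed.

Lemma pairing0l u : pairing 0 u = 0.
Proof. by rewrite /pairing big1 // => i _; rewrite mxE mul0r. Qed.

Lemma pairingMnl y u n : pairing (y *+ n) u = pairing y u *+ n.
Proof. by elim: n => [|n IH]; rewrite ?pairing0l // !mulrS pairingDl IH. Qed.

Lemma pairingDr y u v : pairing y (u + v) = pairing y u + pairing y v.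
Proof. by rewrite -big_split; apply: eq_bigr => i _; rewrite mxE mulrDr. Qed.

Lemma pairingZr y a u : pairing y (a *: u) = a * pairing y u.
Proof. by rewrite mulr_sumr; apply: eq_bigr => i _; rewrite mxE mulrCA. Qed.

Lemma pairing_delta y j : pairing y (delta_mx 0 j) = (y 0 j)%:~R.
Proof.
rewrite /pairing (bigD1 j) //= mxE !eqxx mulr1 big1 ?addr0 // => i /negbTE ij.
by rewrite mxE ij andbF mulr0.
Qed.

End pairing.

Section gordan.
Context (d : nat).
Implicit Types (s t : seq 'rV[int]_d).

(** The second alternative of Gordan's theorem: a list with repetitions encodes a nontrivial
    combination with coefficients in nat. *)
Definition null_multiset s t :=
  [/\ t != [::], {subset t <= s} & \sum_(y <- t) y = 0].

(** Replacing each [w] of the null list by a list over [s] with sum [w] carries a null combination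
    back through the elimination. *)
Lemma null_multiset_flatten s s' :
  {in s', forall w, exists2 t, t != [::] /\ {subset t <= s} & \sum_(y <- t) y = w} ->
  (exists t, null_multiset s' t) -> exists t, null_multiset s t.
Proof.
move=> ss' [t [t0 ts' sum_t]].
suff [t' [t'0 t's sum_t']] : exists t', [/\ t != [::] -> t' != [::],
    {subset t' <= s} & \sum_(y <- t') y = \sum_(y <- t) y].
  by exists t'; split; rewrite ?t'0 ?sum_t'.
elim: t {t0 sum_t} ts' => [|w t IH] ts'; first by exists [::].
have [t' [_ t's sum_t']] := IH (fun y yt => ts' y (@mem_behead _ (w :: t) y yt)).
have [r [r0 rs] sum_r] := ss' _ (ts' w (mem_head _ _)).
exists (r ++ t'); split.
- by case: r r0 {rs sum_r}.
- by move=> y; rewrite mem_cat => /orP[/rs|/t's].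
- by rewrite big_cat big_cons /= sum_r sum_t'.
Qed.

(* Fourier-Motzkin elimination of the last coordinate on which some vector of
   s is nonzero. *)
Lemma gordan_restricted (F : realFieldType) k s :
  {in s, forall (y : 'rV[int]_d) (i : 'I_d), (k <= i)%N -> y 0 i = 0} ->
  (exists u : 'rV[F]_d, {in s, forall y, 0 < pairing y u}) \/
  exists t, null_multiset s t.
Proof.
elim: k s => [|k IH] s sk.
  case: s sk => [|y s] sk; first by left; exists 0.
  right; exists [:: y]; split => // [z|]; first by rewrite !inE => ->.
  by rewrite big_seq1; apply/rowP => i; rewrite mxE (sk y) ?mem_head.
have [kd|dk] := ltnP k d; last first.
  by apply: IH => y ys i ki; move: (ltn_ord i); rewrite ltnNge (leq_trans dk ki).
pose j := Ordinal kd.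
pose sp := [seq y : 'rV[int]_d <- s | 0 < y 0 j].
pose sn := [seq y : 'rV[int]_d <- s | y 0 j < 0].
(* The weights [|z_j|] and [|y_j|] are in nat and cancel coordinate [j], as [y_j > 0 > z_j]. *)
pose comb (y z : 'rV[int]_d) := y *+ `|z 0%R j|%N + z *+ `|y 0%R j|%N.
pose s' := [seq y : 'rV[int]_d <- s | y 0 j == 0] ++ [seq comb y z | y <- sp, z <- sn].
case: (IH s').
- move=> w; rewrite mem_cat => /orP[|/allpairsP[[y z] /= [yp zn ->]]] => [|i].
    rewrite mem_filter => /andP[/eqP yj ys] i; rewrite leq_eqVlt.
    move=> /predU1P[ki|]; last exact: sk.
    by rewrite -yj; congr (w _ _); exact: val_inj.
  move: yp zn; rewrite !mem_filter => /andP[yj ys] /andP[zj zs].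
  rewrite !mxE !mulmxnE leq_eqVlt => /predU1P[ki|ki]; last first.
    by rewrite (sk y _ i) // (sk z _ i) // !mul0rn.
  have -> : i = j by exact: val_inj.
  by rewrite -[X in X + _]mulr_natr -[X in _ + X]mulr_natr !natz !abszE
    (gtr0_norm yj) (ltr0_norm zj); ring.
- move=> [u us'].
  (* [u + c e_j] pairs positively with [y] iff [c > ratio y] when [y_j > 0], and iff [c < ratio y]
     when [y_j < 0]. Positivity of [u] on [comb y z] says [ratio y < ratio z]. *)
  pose ratio y : F := - pairing y u / (y 0 j)%:~R.
  case: (@separating_point F [seq ratio y | y <- sp] [seq ratio z | z <- sn]).
    move=> _ _ /mapP[y yp ->] /mapP[z zn ->].
    have := us' (comb y z); rewrite mem_cat.
    have -> : comb y z \in [seq comb y z | y <- sp, z <- sn].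
      by apply/allpairsP; exists (y, z).
    rewrite orbT => /(_ isT); rewrite pairingDl !pairingMnl.
    move: yp zn; rewrite !mem_filter => /andP[yj ys] /andP[zj zs].
    rewrite -[X in X + _]mulr_natr -[X in _ + X]mulr_natr !pmulrn !abszE
      (gtr0_norm yj) (ltr0_norm zj).
    have yF : 0 < (y 0 j)%:~R :> F by rewrite ltr0z.
    have zF : 0 < (- z 0 j)%:~R :> F by rewrite ltr0z oppr_gt0.
    rewrite /ratio => yz.
    have -> : - pairing z u / (z 0 j)%:~R = pairing z u / (- z 0 j)%:~R.
      by rewrite intrN invrN mulrN mulNr.
    rewrite ltr_pdivrMr // mulrAC ltr_pdivlMr // mulNr -subr_gt0 opprK addrC.
    exact: yz.
  move=> c [Lc cH]; left; exists (u + c *: delta_mx 0 j) => y ys.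
  rewrite pairingDr pairingZr pairing_delta.
  have [yj|yj|yj] := ltgtP (y 0 j) 0.
  + have yF : (y 0 j)%:~R < 0 :> F by rewrite ltrz0.
    have := cH (ratio y) (map_f _ _); rewrite mem_filter yj ys => /(_ isT).
    rewrite /ratio ltr_ndivlMr // => ?; lra.
  + have yF : 0 < (y 0 j)%:~R :> F by rewrite ltr0z.
    have := Lc (ratio y) (map_f _ _); rewrite mem_filter yj ys => /(_ isT).
    rewrite /ratio ltr_pdivrMr // => ?; lra.
  + by rewrite yj mulr0 addr0 us' // mem_cat mem_filter yj eqxx ys.
- move=> s't; right; apply: null_multiset_flatten s't => w.
  rewrite mem_cat => /orP[|/allpairsP[[y z] /= [yp zn ->]]].
    rewrite mem_filter => /andP[_ ws]; exists [:: w]; last by rewrite big_seq1.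
    by split => // y; rewrite inE => /eqP ->.
  move: yp zn; rewrite !mem_filter => /andP[yj ys] /andP[zj zs].
  exists (nseq `|z 0%R j|%N y ++ nseq `|y 0%R j|%N z).
    split; last by move=> x; rewrite mem_cat !mem_nseq => /orP[]/andP[_ /eqP ->].
    by rewrite -size_eq0 size_cat !size_nseq addn_eq0 !absz_eq0 (lt_eqF zj).
  by rewrite big_cat /= !big_nseq !iter_addr_0.
Qed.

Lemma gordan (F : realFieldType) s :
  (exists u : 'rV[F]_d, {in s, forall y, 0 < pairing y u}) \/
  exists t, null_multiset s t.
Proof.
by apply: (@gordan_restricted _ d) => y _ i; rewrite leqNgt ltn_ord.
Qed.

End gordan.

(** * Finite blocking sets *)

Definition inert (d : nat) (U : {fset {fset 'rV[int]_d}})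
    (K : {fset 'rV[int]_d}) : Prop :=
  forall x X, x \in K -> X \in U -> exists2 y, y \in X & x + y \in K.

(** The first site of [K] to be infected would need another site of [K] infected earlier. *)
Lemma inert_not_percolates (d : nat) (U : {fset {fset 'rV[int]_d}})
    (K : {fset 'rV[int]_d}) (A : set 'rV[int]_d) :
  inert U K -> K != fset0 -> (forall x, x \in K -> ~ A x) -> ~ percolates U A.
Proof.
move=> inertK /fset0Pn[x0 x0K] KA perc.
have : closure_of U A x0 by rewrite perc.
case=> t _; elim: t x0 x0K => [|t IH] x xK; first exact: KA.
case=> [|[X XU xX]]; first exact: IH.
by have [y yX xyK] := inertK x X xK XU; exact: IH xyK (xX y yX).
Qed.

Lemma inert_translate (d : nat) (U : {fset {fset 'rV[int]_d}})
    (K : {fset 'rV[int]_d}) (v : 'rV[int]_d) :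
  inert U K -> inert U [fset (v + x)%R | x in K]%fset.
Proof.
move=> inertK _ X /imfsetP[x /= xK ->] XU.
have [y yX xyK] := inertK x X xK XU; exists y => //.
by rewrite -addrA; apply/imfsetP; exists (x + y).
Qed.

(** Rewrites a list as a combination over [Y] with multiplicities as coefficients, the form of the
    points of the zonotope. *)
Lemma sum_count_mem (V : zmodType) (Y : {fset V}) (t : seq V) :
  {subset t <= Y} -> \sum_(y : Y) val y *+ count_mem (val y) t = \sum_(y <- t) y.
Proof.
elim: t => [|z t IH] tY; first by rewrite big_nil big1.
rewrite big_cons -IH => [|y yt]; last by apply: tY; rewrite inE yt orbT.
rewrite /=; under eq_bigr do rewrite mulrnDr; rewrite big_split /=; congr (_ + _).
rewrite (bigD1 [` tY z (mem_head _ _)]%fset) //= eqxx mulr1n big1 ?addr0 // => y.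
by rewrite -val_eqE /= eq_sym => /negbTE ->.
Qed.

(* The set K is the discrete zonotope of sums of c_y y with 0 <= c_y <= N. If
   no y in X can be added to a point of K, then c_y = N on X, and subtracting
   the null multiset of X makes room without moving the point. *)
Lemma null_multiset_inert (d : nat) (U : {fset {fset 'rV[int]_d}}) :
  (forall X, X \in U -> exists t, null_multiset (enum_fset X) t) ->
  exists2 K, K != fset0 & inert U K.
Proof.
move=> nullU.
have [t nullt] : {t : {fset 'rV[int]_d} -> seq 'rV[int]_d &
    forall X, X \in U -> null_multiset (enum_fset X) (t X)}.
  apply: (@choice _ _ (fun X t => X \in U -> null_multiset (enum_fset X) t)) => X.
  have [XU|] := boolP (X \in U); last by exists [::].
  by have [t] := nullU X XU; exists t.
pose Y := (\bigcup_(X <- U) X)%fset.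
have XY X y : X \in U -> y \in X -> y \in Y.
  by move=> XU yX; apply/bigfcupP; exists X => //; rewrite XU.
(* [N] bounds every multiplicity in the chosen null multisets, so these can be subtracted from
   coefficients equal to [N]. *)
pose N := (\max_(X <- U) size (t X)).+1.
pose point (c : 'rV[int]_d -> nat) := \sum_(y : Y) val y *+ c (val y).
pose K := [fset x in [seq \sum_(y : Y) val y *+ c y |
  c : {ffun Y -> 'I_N.+1} <- enum {: {ffun Y -> 'I_N.+1}}]]%fset.
have pointK c : (forall y, (c y <= N)%N) -> point c \in K.
  move=> cN; rewrite inE; apply/mapP.
  exists [ffun y : Y => inord (c (val y))]; first by rewrite mem_enum.
  by apply: eq_bigr => y _; rewrite ffunE inordK // ltnS.
have Kpoint x : x \in K -> exists2 c, (forall y, (c y <= N)%N) & x = point c.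
  rewrite inE => /mapP[c _ ->].
  (* Coefficients are extended by 0 outside [Y], where they do not enter the sum. *)
  exists (fun y => if insub y is Some y' then c y' : nat else 0%N).
    by move=> y; case: insubP => // y' _ _; rewrite -ltnS.
  by apply: eq_bigr => y _; rewrite valK.
have point_add c y : y \in Y -> point c + y = point (fun z => c z + (z == y))%N.
  move=> yY; rewrite /point; under [RHS]eq_bigr do rewrite mulrnDr.
  rewrite big_split /=; congr (_ + _).
  rewrite (bigD1 [` yY]%fset) //= eqxx mulr1n big1 ?addr0 // => z.
  by rewrite -val_eqE /= => /negbTE ->.
exists K.
  by apply/fset0Pn; exists (point (fun=> 0%N)); exact: pointK.
move=> x X /Kpoint[c cN ->] XU.
have [[y [yX cy]]|full] := pselect (exists y, y \in X /\ (c y < N)%N).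
  exists y => //; rewrite point_add; last exact: XY yX.
  apply: pointK => z; have [->|_] := eqVneq z y; first by rewrite addn1.
  by rewrite addn0.
have {}full y : y \in X -> c y = N.
  move=> yX; apply/eqP; rewrite eqn_leq cN leqNgt; apply/negP => cy.
  by apply: full; exists y.
have [tX0 tXX sum_tX] := nullt X XU.
have [y ytX] : exists y, y \in t X.
  by case: (t X) tX0 => // y s _; exists y; rewrite mem_head.
have countN z : (count_mem z (t X) < N)%N.
  rewrite ltnS (leq_trans (count_size _ _)) //.
  exact: (@leq_bigmax_seq _ _ xpredT (fun X => size (t X)) X XU).
have count_c z : (count_mem z (t X) <= c z)%N.
  have [/tXX/full ->|/count_memPn ->//] := boolP (z \in t X).
  exact: ltnW.
exists y; first exact: tXX.
have -> : point c = point (fun z => c z - count_mem z (t X))%N.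
  rewrite -[RHS]addr0 -sum_tX -(@sum_count_mem _ Y); last by move=> z /tXX; exact: XY.
  by rewrite -big_split; apply: eq_bigr => z _; rewrite /= -mulrnDr subnK.
rewrite point_add; last by apply: XY XU (tXX _ ytX).
apply: pointK => z; have [->|_] := eqVneq z y.
  (* Since [y] occurs in [t X], the subtraction lowered its coefficient by at least 1, which leaves
     room for the added [y]. *)
  have : (0 < count_mem y (t X))%N by rewrite -has_count has_pred1.
  have := count_c y; have := cN y; rewrite addn1; lia.
by rewrite addn0 (leq_trans (leq_subr _ _)).
Qed.

Lemma disjoint_translates (d : nat) (K : {fset 'rV[int]_d}) (n : nat) :
  (0 < d)%N -> exists vs : seq 'rV[int]_d, size vs = n /\
    pairwise (fun v w =>
      [disjoint [fset (v + x)%R | x in K] & [fset (w + x)%R | x in K]]%fset) vs.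
Proof.
move=> d0; elim: n => [|n [vs [<- vsK]]]; first by exists [::].
(* One coordinate separates the translates: [M] exceeds [|v_0| + |x_0| + |y_0|] for every earlier
   [v] and all [x], [y] in [K]. *)
pose M : int := \sum_(v <- vs) `|v 0 (Ordinal d0)| +
  2 * (\sum_(x <- K) `|x 0 (Ordinal d0)|) + 1.
have leK x : x \in K -> `|x 0 (Ordinal d0)| <= \sum_(x <- K) `|x 0 (Ordinal d0)|.
  by move=> xK; rewrite (big_fsetD1 x) //= lerDl sumr_ge0.
exists (const_mx M :: vs); split => //=; rewrite vsK andbT.
apply/allP => v vvs.
have lev : `|v 0 (Ordinal d0)| <= \sum_(v <- vs) `|v 0 (Ordinal d0)|.
  by rewrite (perm_big _ (perm_to_rem vvs)) big_cons lerDl sumr_ge0.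
apply/fdisjointP => _ /imfsetP[x /= /leK xK ->].
apply/negP => /imfsetP[y /= /leK yK] /rowP/(_ (Ordinal d0)).
rewrite !mxE {}/M; move: xK yK lev; set S := \sum_(_ <- _) _; set S' := \sum_(_ <- _) _.
by move: (x 0 _) (y 0 _) (v 0 _) => x0 y0 v0; lia.
Qed.

(** * Probability that finite sets are avoided *)

Lemma exists_expr_lt (R : realType) (z e : R) :
  0 <= z < 1 -> 0 < e -> exists n, z ^+ n < e.
Proof.
move=> /andP[z0 z1] e0; have := @cvg_expr R z; rewrite ger0_norm // => /(_ z1).
move/cvgrPdist_lt => /(_ e e0)[n _ /(_ n (leqnn n))] /=.
by rewrite sub0r normrN ger0_norm ?exprn_ge0 //; exists n.
Qed.

(** Induction on [Ks]: excluding [H K] subtracts the same event with [S] enlarged to [S] union [K],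
    which is why [S] is carried along. [H] is abstract because it serves twice, for sets contained
    in A and for sets disjoint from A. *)
Lemma prob_no_block (disp : measure_display) (W : measurableType disp)
    (R : realType) (P : probability W R) (T : choiceType)
    (H : {fset T} -> set W) (a : R) (k : nat) :
  (forall S, measurable (H S)) ->
  (forall S S', H (S `|` S')%fset = H S `&` H S') ->
  (forall S, P (H S) = (a ^+ #|` S|)%:E) ->
  forall (Ks : seq {fset T}) (S : {fset T}),
    all (fun K => #|` K| == k) Ks -> pairwise fdisjoint Ks ->
    all (fdisjoint S) Ks ->
    P (H S `&` \bigcap_(K in [set` Ks]) ~` H K) =
      (a ^+ #|` S| * (1 - a ^+ k) ^+ size Ks)%:E.
Proof.
move=> mH HU PH Ks S; rewrite bigcap_seq.
elim: Ks S => [|K Ks IH] S /=; first by rewrite big_nil setIT mulr1 PH.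
move=> /andP[/eqP Kk Ksk] /andP[KKs disjKs] /andP[SK SKs].
rewrite big_cons; set B := \big[_/_]_(_ <- _) _ in IH *.
have mB : measurable B.
  rewrite /B -bigcap_seq; apply: fin_bigcap_measurable => // L _.
  exact: measurableC.
have -> : H S `&` (~` H K `&` B) = (H S `&` B) `\` H K.
  by rewrite setDE -setIA [_ `&` B]setIC.
rewrite measureD //; last 2 first.
- exact: measurableI.
- exact: le_lt_trans (probability_le1 P (measurableI _ _ (mH S) mB)) (ltry 1).
rewrite -setIA [B `&` _]setIC setIA -HU.
rewrite [X in (X - _)%E]IH // [X in (_ - X)%E]IH //; last first.
  by apply/allP => L LKs; rewrite fdisjointUX (allP SKs) ?(allP KKs).
rewrite cardfsU (eqP SK) cardfs0 subn0 Kk -EFinB; congr EFin.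
by rewrite exprS exprD; ring.
Qed.

Section p_random_law.
Context (R : realType) (T : choiceType) (p : R).
Context (P : probability (random_set_space T) R).
Hypothesis Pp : p_random_law p P.

Definition avoiding (S : {fset T}) : set (random_set_space T) :=
  [set A | forall x, x \in S -> ~ A x].

Lemma measurable_site_event (x : T) :
  measurable (site_event x : set (random_set_space T)).
Proof. by apply: sub_sigma_algebra; exists x. Qed.

Lemma measurable_avoiding S : measurable (avoiding S).
Proof.
have -> : avoiding S = \bigcap_(x in [set` S]) ~` site_event x by [].
by apply: fin_bigcap_measurable => // x _; apply: measurableC;
  exact: measurable_site_event.
Qed.

Lemma avoidingU S S' : avoiding (S `|` S')%fset = avoiding S `&` avoiding S'.
Proof.
apply/seteqP; split=> A; last first.
  by case=> AS AS' x; rewrite inE => /orP[/AS|/AS'].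
by move=> ASS'; split=> x xS; apply: ASS'; rewrite inE xS ?orbT.
Qed.

(** The law is specified only through inclusion events; the blocks here are the singletons of [S],
    with [H F] the event that [F] lies in A. *)
Lemma prob_avoiding S : P (avoiding S) = ((1 - p) ^+ #|` S|)%:E.
Proof.
pose H (S : {fset T}) : set (random_set_space T) :=
  \bigcap_(x in [set` S]) site_event x.
have PH F : P (H F) = (p ^+ #|` F|)%:E.
  rewrite (proj2 Pp); under eq_bigr do rewrite (proj1 Pp).
  by rewrite prodEFin big_const_seq count_predT iter_mulr_1.
have := @prob_no_block _ _ _ P _ H p 1 _ _ PH [seq [fset x]%fset | x <- S] fset0.
rewrite cardfs0 mul1r expr1 size_map => <-.
- congr (P _); apply/seteqP; split => A.
    move=> AS; split=> [x|_ /= /mapP[x xS ->]]; first by rewrite /= inE.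
    by rewrite /H set_fset1 bigcap_set1; exact: AS.
  move=> [_ AS] x xS; have := AS [fset x]%fset; rewrite /H set_fset1 bigcap_set1.
  by apply; exact: map_f.
- by move=> F; apply: fin_bigcap_measurable => // x _; exact: measurable_site_event.
- by move=> F G; rewrite /H set_fsetU bigcap_setU.
- by rewrite all_map; apply/allP => x _ /=; rewrite cardfs1.
- rewrite pairwise_map; have := fset_uniq S; rewrite uniq_pairwise.
  by apply: sub_pairwise => x y /= xy; rewrite fdisjoint1X inE.
- by apply/allP => K _; rewrite fdisjoint0X.
Qed.

Lemma prob_avoiding_union_le (s : seq {fset T}) (c : R) :
  {in s, forall F : {fset T}, (1 - p) ^+ #|` F| <= c} ->
  (P (\bigcup_(F in [set` s]) avoiding F) <= ((size s)%:R * c)%:E)%E.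
Proof.
elim: s => [|F s IH] sc.
  by rewrite set_nil bigcup_set0 measure0 mul0r.
rewrite bigcup_seq big_cons -bigcup_seq.
rewrite (le_trans (measureU2 _ _ _)) //; first exact: measurable_avoiding.
  by apply: fin_bigcup_measurable => // G _; exact: measurable_avoiding.
rewrite [size _]/= -addn1 natrD mulrDl mul1r EFinD addeC leeD //.
  by rewrite [leLHS]prob_avoiding lee_fin sc ?mem_head.
by apply: IH => G Gs; apply: sc; rewrite inE Gs orbT.
Qed.

End p_random_law.

(** * Bounds on the probability of percolation *)

Section percolation.
Context (R : realType) (d : nat) (U : {fset {fset 'rV[int]_d}}) (p : R).
Context (P : probability (random_set_space 'rV[int]_d) R).
Hypothesis Pp : p_random_law p P.

(** Percolation forces A to meet each of [n] disjoint translates of [K], an event of probability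
    [(1 - (1 - p)^|K|)^n]. *)
Lemma inert_prob_percolates_lt (K : {fset 'rV[int]_d}) :
  (0 < d)%N -> 0 <= p < 1 -> K != fset0 -> inert U K ->
  forall e, 0 < e -> (P (percolates U) < e%:E)%E.
Proof.
move=> d0 /andP[p0 p1] K0 inertK e e0.
have q01 : 0 <= 1 - (1 - p) ^+ #|` K| < 1.
  have q0 : 0 < 1 - p by rewrite subr_gt0.
  rewrite subr_ge0 exprn_ile1  ?(ltW q0) ?gerBl //=.
  by rewrite gtrBl exprn_gt0.
have [n ne] := exists_expr_lt q01 e0.
have [vs [svs disj_vs]] := disjoint_translates K n d0.
pose Ks := [seq [fset (v + x)%R | x in K]%fset | v <- vs].
have := @prob_no_block _ _ _ P _ _ (1 - p) #|` K|
  (@measurable_avoiding _) (@avoidingU _) (prob_avoiding Pp) Ks fset0.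
rewrite cardfs0 mul1r size_map svs.
have -> : avoiding fset0 = setT :> set (random_set_space 'rV[int]_d).
  by apply/seteqP; split=> // A _ x; rewrite inE.
rewrite setTI => PKs.
apply: (@le_lt_trans _ _ ((1 - (1 - p) ^+ #|` K|) ^+ n)%:E); last by rewrite lte_fin.
rewrite -PKs; first last.
- by apply/allP => L _; rewrite fdisjoint0X.
- by rewrite pairwise_map.
- rewrite all_map; apply/allP => v _ /=; rewrite card_imfset //; exact: addrI.
apply: le_measure; rewrite ?inE.
- exact: measurable_percolates.
- apply: fin_bigcap_measurable => // L _; apply: measurableC.
  exact: measurable_avoiding.
- move=> A perc _ /= /mapP[v _ ->] AK.
  apply: inert_not_percolates AK perc; first exact: inert_translate.
  by have /fset0Pn[x xK] := K0; apply/fset0Pn; exists (v + x); apply/imfsetP; exists x.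
Qed.

(** A countable union over sites. Negligibility avoids a separate measurability proof for each
    per-site event. *)
Lemma negligible_prob_percolates :
  (forall x, P.-negligible [set A | ~ closure_of U A x]) ->
  P (percolates U) = 1%E.
Proof.
move=> negl; have mperc := measurable_percolates U.
suff : P (~` percolates U) = 0%E.
  move=> perc0; have := probability_setC P (measurableC mperc).
  by rewrite setCK perc0 sube0.
apply/negligibleP; first exact: measurableC.
pose N k : set (random_set_space 'rV[int]_d) :=
  if choice.unpickle k is Some x then [set A | ~ closure_of U A x] else set0.
apply: (@negligibleS _ _ _ _ (\bigcup_k N k)); last first.
  apply: negligible_bigcup => k; rewrite /N; case: choice.unpickle => //.
  exact: negligible_set0.
move=> A nperc; have [x Ax] : exists x, ~ closure_of U A x.
  apply/not_existsP => AU; apply: nperc; apply/seteqP; split => // x _.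
  by apply: contrapT => /AU.
by exists (choice.pickle x) => //; rewrite /N choice.pickleK.
Qed.

End percolation.

(** * Routes of healthy sites *)

Lemma subset_iter_update (d : nat) (U : {fset {fset 'rV[int]_d}})
    (A : set 'rV[int]_d) (m n : nat) :
  (m <= n)%N -> iter m (update U) A `<=` iter n (update U) A.
Proof.
move=> /subnK <-; elim: (n - m)%N => [//|k IH] x /IH Ax.
by rewrite addSn /=; left.
Qed.

(** As [X] is finite, a single time [t] works for all the sites [x + y]. *)
Lemma closure_of_update (d : nat) (U : {fset {fset 'rV[int]_d}})
    (A : set 'rV[int]_d) (x : 'rV[int]_d) (X : {fset 'rV[int]_d}) :
  X \in U -> (forall y, y \in X -> closure_of U A (x + y)) -> closure_of U A x.
Proof.
move=> XU xX; have [t tX] : exists t, forall y, y \in X -> iter t (update U) A (x + y).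
  elim/finSet_rect: X {XU} xX => X IH xX.
  have [->|/fset0Pn[y yX]] := eqVneq X fset0; first by exists 0%N => y; rewrite inE.
  have [|z|t tX] := IH (X `\ y)%fset; first exact: fproperD1.
    by rewrite !inE => /andP[_]; exact: xX.
  have [t' _ ty] := xX y yX.
  exists (maxn t t') => z zX; have [->|zy] := eqVneq z y.
    exact: subset_iter_update (leq_maxr _ _) _ ty.
  by apply: subset_iter_update (leq_maxl t t') _ _; apply: tX; rewrite !inE zy.
by exists t.+1 => //=; right; exists X.
Qed.

Section routes.
Context (d : nat) (X : {fset 'rV[int]_d}).

(** A route is kept as the set of its sites, as avoidance depends on nothing else. The list may
    repeat sets, so its size is exactly [|X|^n]. *)
Fixpoint routes (n : nat) (x : 'rV[int]_d) : seq {fset 'rV[int]_d} :=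
  if n is m.+1 then [seq (x |` F)%fset | y <- X, F <- routes m (x + y)]
  else [:: [fset x]%fset].

Lemma size_routes n x : size (routes n x) = (#|` X| ^ n)%N.
Proof.
elim: n x => [//|n IH] x; rewrite /= size_allpairs_dep.
under eq_map do rewrite IH.
by rewrite sumnE big_map big_const_seq count_predT iter_addn_0 expnS mulnC.
Qed.

Lemma card_route (R : realType) (u : 'rV[R]_d) n x F :
  (forall y, y \in X -> pairing y u < 0) -> F \in routes n x -> #|` F| = n.+1.
Proof.
(* Strengthened for the induction: the tail of a route lies strictly below its start along [u],
   hence does not contain it. *)
move=> Xu; suff cardF : F \in routes n x ->
    #|` F| = n.+1 /\ (forall z, z \in F -> pairing z u <= pairing x u).
  by move=> /cardF[].
elim: n x F => [|n IH] x F /=.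
  rewrite inE => /eqP ->; rewrite cardfs1; split => // z.
  by rewrite inE => /eqP ->.
move=> /allpairsPdep[y [G [yX /IH[cardG Gx] ->]]].
have {}Gx z : z \in G -> pairing z u < pairing x u.
  by move=> /Gx /le_lt_trans -> //; rewrite pairingDl gtrDl Xu.
rewrite cardfsU1 cardG; split; last first.
  by move=> z; rewrite !inE => /predU1P[->//|/Gx/ltW].
by case: (boolP (x \in G)) => // /Gx; rewrite ltxx.
Qed.

(** A never infected site is healthy in A, and some [y] in [X] leads to another never infected
    site. *)
Lemma route_avoiding (U : {fset {fset 'rV[int]_d}}) (A : set 'rV[int]_d) n x :
  X \in U -> ~ closure_of U A x -> exists2 F, F \in routes n x & avoiding F A.
Proof.
move=> XU; elim: n x => [|n IH] x Ax.
  exists [fset x]%fset; first by rewrite inE.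
  by move=> z; rewrite inE => /eqP -> Az; apply: Ax; exists 0%N.
have [y [yX Axy]] : exists y, y \in X /\ ~ closure_of U A (x + y).
  apply: contrapT => /forallNP Ay; apply: Ax; apply: (closure_of_update XU) => y yX.
  by apply: contrapT => Axy; apply: (Ay y).
have [F Fn AF] := IH _ Axy.
exists (x |` F)%fset; first by apply/allpairsPdep; exists y, F.
move=> z; rewrite !inE => /predU1P[->|]; last exact: AF.
by move=> Ax0; apply: Ax; exists 0%N.
Qed.

End routes.

(* A site that is never infected starts an infinite route of initially healthy
   sites; routes move strictly down u, so they never revisit a site, and
   a union bound over the #|X| ^ n routes of length n applies. *)
Lemma unstable_prob_percolates (R : realType) (d : nat)
    (U : {fset {fset 'rV[int]_d}}) (X : {fset 'rV[int]_d}) (u : 'rV[R]_d) (p : R)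
    (P : probability (random_set_space 'rV[int]_d) R) :
  p_random_law p P -> 0 <= p <= 1 -> X \in U ->
  (forall y, y \in X -> pairing y u < 0) ->
  (1 - p) * #|` X|%:R < 1 -> P (percolates U) = 1%E.
Proof.
move=> Pp /andP[p0 p1] XU Xu pX; apply: negligible_prob_percolates => x.
pose E n : set (random_set_space 'rV[int]_d) :=
  \bigcup_(F in [set` routes X n x]) avoiding F.
have mE n : measurable (E n).
  by apply: fin_bigcup_measurable => // F _; exact: measurable_avoiding.
have q0 : 0 <= 1 - p by rewrite subr_ge0.
apply: (@negligibleS _ _ _ _ (\bigcap_n E n)).
  by move=> A Ax n _; have [F ? ?] := route_avoiding n XU Ax; exists F.
apply/negligibleP; first exact: bigcap_measurable.
apply/eqP; rewrite eq_le measure_ge0 andbT; apply/lee_addgt0Pr => e e0; rewrite add0e.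
have [|n ne] := @exists_expr_lt R ((1 - p) * #|` X|%:R) e _ e0.
  by rewrite pX mulr_ge0.
apply: (@le_trans _ _ (P (E n))).
  apply: le_measure; rewrite ?inE //; first exact: bigcap_measurable.
  by move=> A; apply.
(* A route has [n + 1] sites; bounding one factor [1 - p] by 1 gives the total [((1 - p) |X|)^n]. *)
have := @prob_avoiding_union_le R _ p P Pp (routes X n x) ((1 - p) ^+ n).
rewrite size_routes natrX mulrC -exprMn => /(_ _)/le_trans -> //.
  move=> F /(card_route Xu) ->; rewrite exprS; apply: ler_piMl; first exact: exprn_ge0.
  by rewrite gerBl.
by rewrite lee_fin ltW.
Qed.

(** * Stable directions and the critical probability *)

Section critical_probability.
Context (R : realType) (d : nat) (U : {fset {fset 'rV[int]_d}}).

(** If [0 <= pairing y u] and [x + y] is in the half-space, then so is [x]. *)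
Lemma stable_direction_subset (u : 'rV[R]_d) :
  (forall X, X \in U -> exists2 y, y \in X & 0 <= pairing y u) ->
  closure_of U (half_space u) = half_space u.
Proof.
move=> Uu; apply/seteqP; split => x; last by exists 0%N.
case=> t _; elim: t x => [//|t IH] x [/IH//|[X XU xX]].
have [y yX yu] := Uu X XU.
have : pairing (x + y) u < 0 by exact: IH (xX y yX).
by rewrite pairingDl; apply: le_lt_trans; rewrite lerDl.
Qed.

(** Otherwise Gordan's theorem gives [u] positive on [X]; in the direction [-u], normalised, the
    half-space contains [X] and infects the origin, which lies outside it. *)
Lemma stable_directions_null_multiset (X : {fset 'rV[int]_d}) :
  stable_directions R U = unit_sphere R d -> X != fset0 -> X \in U ->
  exists t, null_multiset (enum_fset X) t.
Proof.
move=> stable X0 XU; case: (gordan R (enum_fset X)) => // -[u Xu]; exfalso.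
have [y yX] := fset0Pn _ X0.
pose s := \sum_i u 0 i ^+ 2.
have s0 : 0 < s.
  rewrite lt_neqAle sumr_ge0 ?andbT => [|i _]; last exact: sqr_ge0.
  apply/eqP => /esym/eqP; rewrite psumr_eq0 => [/allP u0|i _]; last exact: sqr_ge0.
  have := Xu y yX; rewrite /pairing big1 ?ltxx // => i _.
  by have := u0 i (mem_index_enum _); rewrite sqrf_eq0 => /eqP ->; rewrite mulr0.
pose v := (- (Num.sqrt s)^-1) *: u.
have : unit_sphere R d v.
  rewrite /unit_sphere /=; under eq_bigr do rewrite mxE exprMn.
  by rewrite -mulr_sumr sqrrN exprVn sqr_sqrtr ?ltW // mulVf // gt_eqF.
rewrite -stable => -[_ Hv].
have : half_space v 0.
  rewrite -Hv; exists 1%N => //; right; exists X => // z zX.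
  change (pairing (0 + z) v < 0).
  by rewrite add0r pairingZr mulNr oppr_lt0 mulr_gt0 ?invr_gt0 ?sqrtr_gt0 // Xu.
by change (~ pairing 0 v < 0); rewrite pairing0l ltxx.
Qed.

Lemma critical_probability_lt1 (X : {fset 'rV[int]_d}) (u : 'rV[R]_d) :
  X != fset0 -> X \in U -> (forall y, y \in X -> pairing y u < 0) ->
  critical_probability R U < 1.
Proof.
move=> X0 XU Xu; have n0 : 1 <= #|` X|%:R :> R by rewrite ler1n cardfs_gt0.
have n2 : 0 < 2 * #|` X|%:R :> R by rewrite mulr_gt0 // (lt_le_trans ltr01).
(* At [p = 1 - q] the route bound is [q |X| = 1/2 < 1]. *)
pose q : R := (2 * #|` X|%:R)^-1.
have q0 : 0 < q by rewrite invr_gt0.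
have q1 : q <= 1 by rewrite invf_le1 //; lra.
have p0 : 0 <= 1 - q by rewrite subr_ge0.
have p1 : 1 - q <= 1 by rewrite gerBl ltW.
apply: (@le_lt_trans _ _ (1 - q)); last by rewrite gtrBl.
apply: ge_inf; first by exists 0 => _ [p _ <-].
exists (Itv01 p0 p1) => //=.
rewrite (unstable_prob_percolates (random_set_lawP _ _) _ XU Xu) /= ?p0 //.
  by rewrite lee_fin invf_le1 // ler1n.
rewrite opprB addrCA subrr addr0 /q invfM -mulrA mulVf; last first.
  by rewrite gt_eqF // (lt_le_trans ltr01).
by rewrite mulr1 invf_lt1 // ltr1n.
Qed.

Lemma critical_probability_eq1 (K : {fset 'rV[int]_d}) :
  (0 < d)%N -> K != fset0 -> inert U K -> critical_probability R U = 1.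
Proof.
move=> d0 K0 inertK; rewrite /critical_probability.
suff -> : [set p%:num | p in [set p : {i01 R} |
    (2^-1%:E <= random_set_law 'rV[int]_d p (percolates U))%E]] = [set 1].
  exact: inf1.
apply/seteqP; split => [_ [p perc <-] | _ ->].
  apply/eqP; rewrite eq_le le1 leNgt /=; apply/negP => p1.
  have p01 : 0 <= p%:num < 1 by rewrite ge0.
  have := inert_prob_percolates_lt (random_set_lawP _ p) d0 p01 K0 inertK.
  by move=> /(_ 2^-1); rewrite invr_gt0 ltr0n ltNge perc => /(_ isT).
(* At [p = 1] each given site is healthy with probability 0, so the set of admissible [p] is not
   empty. *)
exists 1%:i01 => //=; rewrite negligible_prob_percolates.
  by rewrite lee_fin invf_le1 // ler1n.
move=> x; apply: (@negligibleS _ _ _ _ (avoiding [fset x]%fset)).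
  by move=> A Ax z; rewrite inE => /eqP -> Axx; apply: Ax; exists 0%N.
apply/negligibleP; first exact: measurable_avoiding.
apply: etrans (prob_avoiding (random_set_lawP _ _) _) _.
by rewrite /= subrr cardfs1.
Qed.

End critical_probability.

Theorem theorem7p1 (R : realType) (d : nat) (hd : (1 <= d)%N)
    (U : {fset {fset 'rV[int]_d}}) (hU : update_family U) :
  critical_probability R U = 1 <->
  stable_directions R U = unit_sphere R d.
Proof.
split=> [pc1|stable].
  apply/seteqP; split=> u; first by case.
  move=> uS; split=> //; apply: stable_direction_subset => X XU.
  (* A rule with no [y] such that [0 <= pairing y u] lies in the open half-space of [u]. *)
  apply: contrapT => Xu; have : critical_probability R U < 1; last by rewrite pc1 ltxx.
  apply: (@critical_probability_lt1 _ _ _ X u) => [|//|y yX].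
    exact: (proj1 (hU X XU)).
  by rewrite ltNge; apply/negP => yu; apply: Xu; exists y.
have [X XU|K K0 inertK] := @null_multiset_inert d U.
  exact: stable_directions_null_multiset stable (proj1 (hU X XU)) XU.
exact: critical_probability_eq1 hd K0 inertK.
Qed.
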